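(* Let $G$ be a $2n$-dimensional Lie group with left-invariant almost Hermitian structure $(\langle\cdot,\cdot\rangle,J,\omega)$, let $e_1,\dots,e_{2n}$ be a standard frame, and let $C^c_{ab}:=\langle[e_a,e_b],e_c\rangle$. For $t\in\mathbb{R}$ let $T^t$ be the torsion of the $t$-Gauduchon connection. Then for $1\le i,j,k\le n$: $$\begin{aligned}\langle T^t(e_i,e_j),e_k\rangle&=\tfrac{t}{4}C^{n+k}_{n+i,j}+\tfrac{t}{4}C^{n+k}_{i,n+j}-\tfrac12C^k_{ij}+\tfrac{-t+1}{2}C^k_{n+i,n+j}+\tfrac14C^{n+i}_{j,n+k}+\tfrac14C^{n+j}_{n+k,i}\\&\quad+\tfrac{-2t+1}{4}C^i_{n+j,n+k}+\tfrac{-2t+1}{4}C^j_{n+k,n+i}+\tfrac{-t+1}{4}C^i_{jk}+\tfrac{t-1}{4}C^{n+j}_{k,n+i}+\tfrac{t-1}{4}C^j_{ik}+\tfrac{-t+1}{4}C^{n+i}_{k,n+j},\end{aligned}$$ $$\begin{aligned}\langle T^t(e_i,e_j),e_{n+k}\rangle&=\tfrac{-2t+1}{4}C^j_{n+i,k}+\tfrac{2t-1}{4}C^i_{n+j,k}+\tfrac{-t+1}{2}C^{n+k}_{n+i,n+j}+\tfrac{-t+1}{4}C^{n+j}_{n+i,n+k}+\tfrac{t-1}{4}C^{n+i}_{n+j,n+k}\\&\quad-\tfrac{t}{4}C^k_{i,n+j}+\tfrac{t-1}{4}C^j_{i,n+k}+\tfrac{-t+1}{4}C^i_{j,n+k}-\tfrac{t}{4}C^k_{n+i,j}-\tfrac12C^{n+k}_{ij}+\tfrac14C^{n+j}_{ik}-\tfrac14C^{n+i}_{jk},\end{aligned}$$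 $$\begin{aligned}\langle T^t(e_i,e_{n+j}),e_k\rangle&=\tfrac{-t+1}{4}C^i_{n+j,k}+\tfrac{t}{4}C^{n+k}_{n+i,n+j}+\tfrac{2t-1}{4}C^{n+j}_{n+i,n+k}-\tfrac{t}{4}C^{n+k}_{ij}+\tfrac{t-1}{4}C^{n+j}_{ik}+\tfrac{-t+1}{4}C^{n+i}_{jk}\\&\quad+\tfrac{2t-1}{4}C^i_{j,n+k}+\tfrac{t-1}{2}C^k_{n+i,j}+\tfrac{t-1}{4}C^j_{n+i,k}+\tfrac14C^{n+i}_{n+j,n+k}-\tfrac12C^k_{i,n+j}+\tfrac14C^j_{i,n+k},\end{aligned}$$ $$\begin{aligned}\langle T^t(e_i,e_{n+j}),e_{n+k}\rangle&=-\tfrac{t}{4}C^k_{n+i,n+j}+\tfrac{t-1}{4}C^j_{n+i,n+k}+\tfrac{-t+1}{4}C^i_{n+j,n+k}+\tfrac{t}{4}C^k_{ij}+\tfrac{-2t+1}{4}C^i_{jk}+\tfrac{t-1}{4}C^{n+j}_{i,n+k}\\&\quad+\tfrac{-t+1}{4}C^{n+i}_{j,n+k}+\tfrac{t-1}{2}C^{n+k}_{n+i,j}+\tfrac{-2t+1}{4}C^{n+j}_{n+i,k}-\tfrac12C^{n+k}_{i,n+j}-\tfrac14C^j_{ik}-\tfrac14C^{n+i}_{n+j,k},\end{aligned}$$ $$\begin{aligned}\langle T^t(e_{n+i},e_{n+j}),e_k\rangle&=\tfrac{-t+1}{4}C^{n+i}_{n+j,k}+\tfrac{-t+1}{2}C^k_{ij}+\tfrac{-t+1}{4}C^j_{ik}+\tfrac{t-1}{4}C^i_{jk}-\tfrac{t}{4}C^{n+k}_{i,n+j}+\tfrac{-2t+1}{4}C^{n+j}_{i,n+k}\\&\quad+\tfrac{2t-1}{4}C^{n+i}_{j,n+k}-\tfrac{t}{4}C^{n+k}_{n+i,j}+\tfrac{t-1}{4}C^{n+j}_{n+i,k}-\tfrac12C^k_{n+i,n+j}+\tfrac14C^j_{n+i,n+k}-\tfrac14C^i_{n+j,n+k},\end{aligned}$$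 $$\begin{aligned}\langle T^t(e_{n+i},e_{n+j}),e_{n+k}\rangle&=\tfrac{t-1}{4}C^{n+j}_{n+i,n+k}+\tfrac{-t+1}{4}C^{n+i}_{n+j,n+k}+\tfrac{-t+1}{2}C^{n+k}_{ij}+\tfrac{2t-1}{4}C^{n+j}_{ik}+\tfrac{t}{4}C^k_{i,n+j}+\tfrac{-t+1}{4}C^j_{i,n+k}\\&\quad+\tfrac{-2t+1}{4}C^{n+i}_{jk}+\tfrac{t-1}{4}C^i_{j,n+k}+\tfrac{t}{4}C^k_{n+i,j}+\tfrac14C^i_{n+j,k}-\tfrac12C^{n+k}_{n+i,n+j}-\tfrac14C^j_{n+i,k}.\end{aligned}$$
   Context: A left-invariant almost Hermitian structure consists of a left-invariant Riemannian metric $\langle\cdot,\cdot\rangle$, a left-invariant almost complex structure $J$ orthogonal for the metric, and $\omega(X,Y)=\langle JX,Y\rangle$. A standard frame is an orthonormal frame of left-invariant vector fields $e_1,\dots,e_n,e_{n+1},\dots,e_{2n}$ with $Je_i=e_{n+i}$ for $1\le i\le n$. The torsion of a connection is $T(X,Y)=\nabla_XY-\nabla_YX-[X,Y]$. For $t\in\mathbb{R}$, the $t$-Gauduchon connection is the unique metric-compatible connection whose torsion $T^t$ is $$\langle T^t(X,Y),Z\rangle=-\tfrac14\langle N(X,Y),Z\rangle-\left(\tfrac{t-2}{4}\right)(d\omega)^+(X,Y,JZ)+\left(\tfrac{3t-2}{4}\right)(d\omega)^+(JX,JY,JZ),$$ where $N(X,Y):=J[JX,Y]+J[X,JY]+[X,Y]-[JX,JY]$;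 for a real 3-form $\eta$, $\eta^+$ is its $(2,1)+(1,2)$-part, $\eta^+(X,Y,Z)=\frac14[3\eta(X,Y,Z)+\eta(JX,JY,Z)+\eta(JX,Y,JZ)+\eta(X,JY,JZ)]$; and $d\omega(X,Y,Z)=-\omega([X,Y],Z)-\omega([Y,Z],X)-\omega([Z,X],Y)$ for left-invariant $X,Y,Z$. *)

(* Defs.v *)
From HB Require Import structures.
From mathcomp Require Import all_boot all_order all_algebra.
From mathcomp Require Import all_classical all_reals all_analysis.
From mathcomp Require Import ring.

Set Implicit Arguments.
Unset Strict Implicit.
Unset Printing Implicit Defensive.

Import Order.TTheory GRing.Theory Num.Theory.
Import numFieldNormedType.Exports.

Local Open Scope classical_set_scope.
Local Open Scope ring_scope.
Section Smooth.
Context {R : realType} {V W : normedModType R}.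

(* This is the usual notion when [U] is open and [V] finite-dimensional;
   ['D_v f] is the directional derivative. *)
Fixpoint continuously_differentiable (k : nat) (U : set V) (f : V -> W) : Prop :=
  if k is k'.+1 then
    (forall x, U x -> differentiable f x) /\
    (forall v, continuously_differentiable k' U (fun x => 'D_v f x))
  else forall x, U x -> {for x, continuous f}.

Definition smooth_on (U : set V) (f : V -> W) : Prop :=
  forall k, continuously_differentiable k U f.

End Smooth.

Section SmoothTheory.
Context {R : realType} {V : normedModType R}.
Implicit Types (U : set V) (f g : V -> R).

Local Notation Ck := continuously_differentiable.

Lemma near_eq_differentiable f g x :
  {near x, f =1 g} -> differentiable f x -> differentiable g x.
Proof.
move=> fg /diff_locallyP[cdf fE].
have gE : g \o shift x = cst (g x) + 'd f x +o_ 0 id.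
  apply/eqaddoP => eps eps0.
  move/eqaddoP: fE => /(_ _ eps0); rewrite -(nbhs_singleton fg).
  have /= : \forall y \near (0 : V), f (y + x) = g (y + x).
    by move: fg; rewrite -[in X in X -> _](add0r x) (near_shift 0)/= subr0 => fg;
      apply: filterS fg => y /=; rewrite add0r.
  by apply: filterS2 => y /=; rewrite !fctE/= => ->.
have dE := diff_unique cdf gE.
by apply/diff_locallyP; rewrite dE.
Qed.

Lemma Ck_eq k U f g : open U -> (forall x, U x -> f x = g x) ->
  Ck k U f -> Ck k U g.
Proof.
move=> oU; elim: k f g => [|k IH] f g fg.
  move=> cf x Ux; change (g @ x --> g x); rewrite -(fg x Ux).
  apply: cvg_trans (cf _ Ux); apply: near_eq_cvg.
  by apply: filterS (open_nbhs_nbhs (conj oU Ux)) => y /fg.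
move=> [df Df]; split=> [x Ux|v].
  apply: near_eq_differentiable (df x Ux).
  by apply: filterS (open_nbhs_nbhs (conj oU Ux)) => y /fg.
apply: IH (Df v) => x Ux; apply: near_eq_derive.
by apply: filterS (open_nbhs_nbhs (conj oU Ux)) => y /fg.
Qed.

Lemma CkW k U f : Ck k.+1 U f -> Ck k U f.
Proof.
elim: k f => [|k IH] f [df Df]; first by move=> x /df/differentiable_continuous.
by split=> // v; exact/IH/Df.
Qed.

Lemma Ck_cst k U (c : R) : Ck k U (fun=> c).
Proof.
elim: k c => [|k IH] c; first by move=> x _; exact: cst_continuous.
split=> [x _|v]; first exact: differentiable_cst.
have -> : (fun x : V => 'D_v (fun=> c) x) = fun=> 0.
  by apply/funext => x; rewrite derive_cst.
exact: IH.
Qed.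

Lemma CkD k U f g : open U -> Ck k U f -> Ck k U g ->
  Ck k U (fun x => f x + g x).
Proof.
move=> oU; elim: k f g => [|k IH] f g.
  by move=> cf cg x Ux; apply: cvgD; [exact: cf|exact: cg].
move=> [df Df] [dg Dg]; split=> [x Ux|v].
  by apply: (@differentiableD _ _ _ f g); [exact: df|exact: dg].
apply: Ck_eq (IH _ _ (Df v) (Dg v)) => // x Ux.
by rewrite -deriveD//; apply: diff_derivable; [exact: df|exact: dg].
Qed.

Lemma CkM k U f g : open U -> Ck k U f -> Ck k U g ->
  Ck k U (fun x => f x * g x).
Proof.
move=> oU; elim: k f g => [|k IH] f g.
  by move=> cf cg x Ux; apply: cvgM; [exact: cf|exact: cg].
move=> Cf Cg; have [df Df] := Cf; have [dg Dg] := Cg; split=> [x Ux|v].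
  by apply: (@differentiableM _ _ f g); [exact: df|exact: dg].
apply: (@Ck_eq _ _ (fun x => f x * 'D_v g x + g x * 'D_v f x)) => // [x Ux|].
  apply/esym/(@deriveM _ _ f g x v); apply: diff_derivable; [exact: df|exact: dg].
by apply: CkD => //; apply: IH;
  first [exact: CkW Cf|exact: CkW Cg|exact: Df|exact: Dg].
Qed.

End SmoothTheory.

(* A chart is given by total functions; only [chart_map] on [chart_dom] and
   [chart_inv] on [chart_cod] are relevant. *)
Record chart (R : realType) (m : nat) (M : topologicalType) := Chart {
  chart_dom : set M ;
  chart_map :> M -> 'rV[R]_m ;
  chart_inv : 'rV[R]_m -> M ;
  chart_cod := chart_map @` chart_dom ;
  chart_dom_open : open chart_dom ;
  chart_cod_open : open chart_cod ;
  chart_mapK : forall x, chart_dom x -> chart_inv (chart_map x) = x ;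
  chart_map_continuous : forall x, chart_dom x -> {for x, continuous chart_map} ;
  chart_inv_continuous : forall u, chart_cod u -> {for u, continuous chart_inv}
}.

HB.mixin Record isLieGroup (R : realType) (m : nat) G
    of Group G & Topological G := {
  lie_hausdorff : hausdorff_space G ;
  lie_second_countable : @second_countable G ;
  atlas : set (chart R m G) ;
  atlas_cover : forall x : G, exists2 c, atlas c & chart_dom c x ;
  atlas_compatible : forall a b, atlas a -> atlas b ->
    smooth_on (a @` (chart_dom a `&` chart_dom b)) (b \o chart_inv a) ;
  lie_mul_continuous : continuous (fun xy : G * G => (xy.1 * xy.2)%g) ;
  lie_inv_continuous : continuous (fun x : G => (x^-1)%g) ;
  lie_mul_smooth : forall a b c, atlas a -> atlas b -> atlas c ->
    smooth_on
      [set u | [/\ chart_cod a u.1, chart_cod b u.2 &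
                   chart_dom c (chart_inv a u.1 * chart_inv b u.2)%g]]
      (fun u : 'rV[R]_m * 'rV[R]_m =>
         c (chart_inv a u.1 * chart_inv b u.2)%g) ;
  lie_inv_smooth : forall a b, atlas a -> atlas b ->
    smooth_on
      [set u | chart_cod a u /\ chart_dom b ((chart_inv a u)^-1)%g]
      (fun u => b ((chart_inv a u)^-1)%g)
}.

#[short(type="lieGroupType")]
HB.structure Definition LieGroup (R : realType) (m : nat) :=
  {G of isLieGroup R m G & Group G & Topological G}.

Section SmoothFunctions.
Context {R : realType} {m : nat} (G : lieGroupType R m).

Definition smooth_fun : {pred G -> R^o} :=
  [pred f | `[< forall c, @atlas R m G c ->
                  smooth_on (chart_cod c) (f \o chart_inv c) >]].

Lemma smooth_fun_subring : subring_closed smooth_fun.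
Proof.
have oC := @chart_cod_open R m G.
have cstP (a : R) : cst a \in smooth_fun.
  by apply/asboolP => c _ k; exact: Ck_cst.
have mulP : GRing.mulr_2closed smooth_fun.
  move=> f g /asboolP sf /asboolP sg; apply/asboolP => c Ac k.
  by apply: CkM => //; [exact: sf|exact: sg].
split=> [|f g sf sg|//]; first exact: (cstP 1).
have /asboolP sNg := mulP _ _ (cstP (-1)) sg.
apply/asboolP => c Ac k; move/asboolP in sf.
have -> : (f - g) \o chart_inv c =
    fun x => (f \o chart_inv c) x + (cst (-1) * g) (chart_inv c x).
  by apply/funext => x; rewrite /= !fctE mulN1r.
by apply: CkD => //; [exact: sf|exact: sNg].
Qed.

HB.instance Definition _ :=
  GRing.isSubringClosed.Build (G -> R^o) smooth_fun smooth_fun_subring.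

Lemma smooth_fun_scaler : GRing.scaler_closed smooth_fun.
Proof.
move=> a f sf.
have -> : a *: f = cst a * f by [].
by apply: rpredM => //; apply/asboolP => c _ k; exact: Ck_cst.
Qed.

HB.instance Definition _ :=
  GRing.isScaleClosed.Build R (G -> R^o) smooth_fun smooth_fun_scaler.

Record smoothFun := SmoothFun {
  smooth_val :> G -> R^o ; _ : smooth_val \in smooth_fun }.

HB.instance Definition _ := [isSub for @smooth_val].
HB.instance Definition _ := [Choice of smoothFun by <:].
HB.instance Definition _ := GRing.SubChoice_isSubComPzRing.Build
  (G -> R^o) smooth_fun smoothFun (subringClosedP smooth_fun).
HB.instance Definition _ := [SubZmodule_isSubLmodule of smoothFun by <:].

End SmoothFunctions.

Section VectorFields.
Context {R : realType} {m : nat} (G : lieGroupType R m).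
Local Notation C := (smoothFun G).

Definition is_derivation (X : C -> C) : Prop :=
  (forall (a : R) (f g : C), X (a *: f + g) = a *: X f + X g) /\
  (forall f g : C, X (f * g) = X f * g + f * X g).

(* Vector fields are the derivations of the algebra of smooth functions; they
   form a module over that algebra.  The regular module [C^o] provides the
   pointwise module structure on [C -> C^o]. *)
Definition derivation : {pred C -> C^o} := [pred X | `[< is_derivation X >]].

Lemma smoothZAl (a : R) (f g : C) : a *: (f * g) = a *: f * g.
Proof. by apply/val_inj/funext => x; exact: mulrA. Qed.

Lemma smoothZAr (a : R) (f g : C) : a *: (f * g) = f * (a *: g).
Proof. by rewrite mulrC smoothZAl mulrC. Qed.

Lemma derivation_submod : submod_closed derivation.
Proof.
split.
  apply/asboolP; split=> [a f g|f g] /=.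
    by rewrite scaler0 addr0.
  by rewrite mul0r mulr0 addr0.
move=> h X Y /asboolP[Xl XM] /asboolP[Yl YM]; apply/asboolP.
split=> [a f g|f g].
  transitivity (h * X (a *: f + g) + Y (a *: f + g)) => //.
  transitivity (a *: (h * X f + Y f) + (h * X g + Y g)) => //.
  by rewrite Xl Yl mulrDr -smoothZAr scalerDr addrACA.
transitivity (h * X (f * g) + Y (f * g)) => //.
transitivity ((h * X f + Y f) * g + f * (h * X g + Y g)) => //.
by rewrite XM YM; ring.
Qed.

HB.instance Definition _ :=
  GRing.isSubmodClosed.Build C (C -> C^o) derivation derivation_submod.

Record vfield := VField {
  vfield_val :> C -> C^o ; _ : vfield_val \in derivation }.

HB.instance Definition _ := [isSub for vfield_val].
HB.instance Definition _ := [Choice of vfield by <:].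
HB.instance Definition _ := [SubChoice_isSubLmodule of vfield by <:].

Lemma bracket_derivation (X Y : vfield) :
  (fun f : C => X (Y f) - Y (X f) : C) \in derivation.
Proof.
case: X Y => [X /= /asboolP[Xl XM]] [Y /= /asboolP[Yl YM]].
apply/asboolP; split=> [a f g|f g].
  by rewrite !(Xl, Yl) scalerBr opprD addrACA.
have D (Z : C -> C) : is_derivation Z -> forall f g, Z (f + g) = Z f + Z g.
  by move=> [Zl _] u v; rewrite -[u]scale1r Zl !scale1r.
rewrite XM YM (D X)// (D Y)// !XM !YM; ring.
Qed.

Definition bracket (X Y : vfield) : vfield := VField (bracket_derivation X Y).

(* [X'] is the image of [X] under the differential of the left translation
   [L_x]; [h] below is [f \o L_x]. *)
Definition left_translate (x : G) (X X' : vfield) : Prop :=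
  forall f h : C, (forall y, h y = f (x * y)%g) ->
    forall y, (X h : C) y = (X' f : C) (x * y)%g.

Definition left_invariant (X : vfield) : Prop :=
  forall x : G, left_translate x X X.

End VectorFields.

Section AlmostHermitian.
Context {R : realType} {m : nat} (G : lieGroupType R m).
Local Notation C := (smoothFun G).
Local Notation X := (vfield G).

(* [metric U V x] is the inner product of [U x] and [V x]. *)
Record left_invariant_almost_hermitian := AlmostHermitian {
  metric : X -> X -> C ;
  metric_linear : forall (f : C) (U V W : X),
    metric (f *: U + V) W = f * metric U W + metric V W ;
  metric_sym : forall U V : X, metric U V = metric V U ;
  metric_ge0 : forall (U : X) (x : G), 0 <= metric U U x ;
  metric_definite : forall (U : X) (x : G),
    metric U U x = 0 -> forall f : C, (U f : C) x = 0 ;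
  metric_left_invariant : forall (x : G) (U V U' V' : X),
    left_translate x U U' -> left_translate x V V' ->
    forall y, metric U V y = metric U' V' (x * y)%g ;
  almost_complex : {linear X -> X} ;
  almost_complex_square : forall U : X, almost_complex (almost_complex U) = - U ;
  almost_complex_left_invariant : forall (x : G) (U U' : X),
    left_translate x U U' ->
    left_translate x (almost_complex U) (almost_complex U') ;
  almost_complex_orthogonal : forall U V : X,
    metric (almost_complex U) (almost_complex V) = metric U V
}.

Context (H : left_invariant_almost_hermitian).
Local Notation "<< U , V >>" := (metric H U V) (format "<< U ,  V >>").
Local Notation J := (almost_complex H).
Local Notation "[[ U , V ]]" := (bracket U V) (format "[[ U ,  V ]]").

Definition omega (U V : X) : C := <<J U, V>>.

(* Cartan's formula for the exterior derivative of a 2-form.  On left-invariant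
   fields the first three terms vanish, see [ext_d_left_invariant]. *)
Definition ext_d (w : X -> X -> C) (U V W : X) : C :=
  U (w V W) + V (w W U) + W (w U V)
  - w [[U, V]] W - w [[V, W]] U - w [[W, U]] V.

(* The (2,1)+(1,2)-part of a real 3-form. *)
Definition plus_part (eta : X -> X -> X -> C) (U V W : X) : C :=
  (4^-1 : R) *: ((3 : R) *: eta U V W + eta (J U) (J V) W
                 + eta (J U) V (J W) + eta U (J V) (J W)).

Definition nijenhuis (U V : X) : X :=
  J [[J U, V]] + J [[U, J V]] + [[U, V]] - [[J U, J V]].

Definition is_connection (D : X -> X -> X) : Prop :=
  [/\ forall (f : C) (U V W : X), D (f *: U + V) W = f *: D U W + D V W,
      forall U V W : X, D U (V + W) = D U V + D U W &
      forall (f : C) (U V : X), D U (f *: V) = (U f : C) *: V + f *: D U V].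

Definition metric_compatible (D : X -> X -> X) : Prop :=
  forall U V W : X, U <<V, W>> = <<D U V, W>> + <<V, D U W>> :> C.

Definition torsion (D : X -> X -> X) (U V : X) : X :=
  D U V - D V U - [[U, V]].

(* At most one [D] qualifies, see [gauduchon_unique]. *)
Definition gauduchon (t : R) (D : X -> X -> X) : Prop :=
  [/\ is_connection D, metric_compatible D &
   forall U V W : X,
     <<torsion D U V, W>> =
       - ((4^-1 : R) *: <<nijenhuis U V, W>>)
       - ((t - 2) / 4) *: plus_part (ext_d omega) U V (J W)
       + ((3 * t - 2) / 4) *: plus_part (ext_d omega) (J U) (J V) (J W)].

Section Checks.
Local Notation D0 := (@vfield_val R m G : X -> C -> C).

Lemma vfieldP (U : X) : is_derivation (D0 U).
Proof. by case: U => U /= /asboolP. Qed.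

Lemma vfield_const (U : X) (f : C) :
  (forall x y, f x = f y) -> U f = 0.
Proof.
have [Ul UM] := vfieldP U.
have U1 : D0 U 1 = 0.
  have /eqP := UM 1 1; rewrite !mulr1 mul1r -subr_eq0 opprD addNKr oppr_eq0.
  by move/eqP.
have U0 : D0 U 0 = 0 by have := UM 0 0; rewrite !mulr0 mul0r addr0.
move=> fc; have -> : f = (f 1%g : R) *: (1 : C) + 0.
  apply/val_inj/funext => x; rewrite addr0 (fc 1%g x).
  by rewrite -[LHS]mulr1.
by rewrite [LHS]Ul U1 U0 scaler0 addr0.
Qed.

Lemma metric_const (U V : X) : left_invariant U -> left_invariant V ->
  forall x y, <<U, V>> x = <<U, V>> y.
Proof.
move=> iU iV x y.
rewrite -{1}(mulgVK y x).
by rewrite -(metric_left_invariant H (iU (x / y)%g) (iV (x / y)%g) y).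
Qed.

Lemma ext_d_left_invariant (U V W : X) :
  left_invariant U -> left_invariant V -> left_invariant W ->
  ext_d omega U V W =
    - omega [[U, V]] W - omega [[V, W]] U - omega [[W, U]] V.
Proof.
have iJ (Y : X) : left_invariant Y -> left_invariant (J Y).
  by move=> iY x; exact: almost_complex_left_invariant (iY x).
move=> iU iV iW; rewrite /ext_d !vfield_const ?add0r// => x y.
- by apply: metric_const => //; exact: iJ.
- by apply: metric_const => //; exact: iJ.
- by apply: metric_const => //; exact: iJ.
Qed.

Lemma gauduchon_unique (t : R) (D D' : X -> X -> X) :
  gauduchon t D -> gauduchon t D' -> D = D'.
Proof.
move=> [_ mD TD] [_ mD' TD'].
have gD U V W : <<U + V, W>> = <<U, W>> + <<V, W>>.
  by rewrite -[U]scale1r metric_linear mul1r scale1r.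
have g0 W : <<0, W>> = 0 by apply: (addrI <<0, W>>); rewrite -gD !addr0.
have gN U W : <<- U, W>> = - <<U, W>>.
  by apply: (addrI <<U, W>>); rewrite -gD !subrr g0.
pose a U V W := <<D U V - D' U V, W>>.
have aC U V W : a U V W = a V U W.
  have := TD U V W; rewrite -TD' /torsion !gD !gN => /addIr e.
  by rewrite /a !gD !gN -[<<D U V, W>>](subrK <<D V U, W>>) e; ring.
have aN U V W : a U V W = - a U W V.
  have := mD U V W; rewrite mD' /a !gD !gN ![metric H V _]metric_sym => /eqP.
  rewrite -subr_eq0 => /eqP e; apply/eqP; rewrite -subr_eq0; apply/eqP.
  by rewrite -[RHS]oppr0 -[X in _ = - X]e; ring.
have a0 U V W x : a U V W x = 0.
  have e : a U V W = - a U V W.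
    by rewrite {1}aN aC aN aC aN aC opprK.
  have : a U V W x = - a U V W x by rewrite {1}e.
  by move=> /eqP; rewrite -addr_eq0 -mulr2n mulrn_eq0 => /eqP.
apply/funext => U; apply/funext => V; apply/eqP; rewrite -subr_eq0; apply/eqP.
apply/val_inj/funext => f; apply/val_inj/funext => x.
exact: metric_definite (a0 U V _ x) f.
Qed.

End Checks.

End AlmostHermitian.

(* A standard frame of a [2n]-dimensional group: [e_i] is [e (lshift n i)] and
   [e_(n+i)] is [e (rshift n i)].  Being orthonormal, the [2n] fields form a
   basis of every tangent space. *)
Definition standard_frame (R : realType) (n : nat) (G : lieGroupType R (n + n))
    (H : left_invariant_almost_hermitian G) (e : 'I_(n + n) -> vfield G) : Prop :=
  [/\ forall a, left_invariant (e a),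
      forall a b (x : G), metric H (e a) (e b) x = (a == b)%:R &
      forall i : 'I_n, almost_complex H (e (lshift n i)) = e (rshift n i)].

Definition structure_fun (R : realType) (n : nat) (G : lieGroupType R (n + n))
    (H : left_invariant_almost_hermitian G) (e : 'I_(n + n) -> vfield G)
    (a b c : 'I_(n + n)) : smoothFun G := metric H (bracket (e a) (e b)) (e c).

(* Main.v *)
Require Import Defs.
From mathcomp Require Import all_boot all_order all_algebra reals.
From mathcomp Require Import boolp ring.

Import GRing.Theory.

Local Open Scope ring_scope.

(** Each of the six formulas is the value, at one of the triples
    (e_i, e_j, e_k), (e_i, e_j, Je_k), ..., (Je_i, Je_j, Je_k), of a single
    identity valid for all left-invariant fields U, V, W
    ([gauduchon_torsion]).  Left-invariance makes [omega] constant on the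
    fields at hand, so that d omega involves brackets only.  Since J squares
    to -1, the two (2,1)+(1,2)-parts in the definition of the torsion are
    combinations of the same four values of d omega, at (U, V, JW),
    (JU, JV, JW), (JU, V, W) and (U, JV, W), and adding the coefficients gives

      < T(U, V), W > = - < N(U, V), W > / 4 + d omega(U, V, JW) / 4
        + (2t - 1)/4 d omega(JU, JV, JW)
        + (t - 1)/4 (d omega(JU, V, W) + d omega(U, JV, W)).

    Expanding N and d omega leaves twelve metric products of a bracket with a
    field.  On a standard frame J sends e_i to e_(n+i) and e_(n+i) to - e_i,
    so each of the twelve terms becomes, up to sign, a structure function. *)

Section Pointwise.
Context {R : realType} {m : nat} {G : lieGroupType R m}.
Implicit Types f g : smoothFun G.

Lemma smoothP f g : (forall x, f x = g x) -> f = g.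
Proof. by move=> fg; apply/val_inj/funext. Qed.

(** Turns an identity between smooth functions with scalar coefficients into
    one in the field of reals, where the coefficients multiply. *)
Lemma smoothE (x : G) :
  ((forall f g, ((f + g) x = f x + g x :> R)%R) *
   (forall f, ((- f) x = - f x :> R)%R) *
   (forall (a : R) f, ((a *: f) x = a * f x :> R)%R))%type.
Proof. by []. Qed.

End Pointwise.

Section Bracket.
Context {R : realType} {m : nat} {G : lieGroupType R m}.
Implicit Types U V : vfield G.

Lemma vfieldN U (f : smoothFun G) : U (- f) = - (U f : smoothFun G).
Proof.
have [Ul _] := vfieldP U.
have U0 : (U 0 : smoothFun G) = 0.
  have /(congr1 (fun z => z - U 0)) := Ul 1 0 0.
  by rewrite scaler0 scale1r addr0 addrK subrr.
by have := Ul (-1) f 0; rewrite addr0 !scaleN1r U0 addr0.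
Qed.

Lemma bracketC U V : bracket V U = - bracket U V.
Proof. by apply/val_inj/funext => f; rewrite /= -opprB. Qed.

Lemma bracketNl U V : bracket (- U) V = - bracket U V.
Proof.
apply/val_inj/funext => f.
change (- (U (V f) : smoothFun G) - V (- (U f : smoothFun G)) =
  - ((U (V f) : smoothFun G) - V (U f))).
by rewrite vfieldN opprB opprK addrC.
Qed.

Lemma bracketNr U V : bracket U (- V) = - bracket U V.
Proof. by rewrite bracketC bracketNl opprK bracketC. Qed.

End Bracket.

Section Gauduchon.
Context {R : realType} {m : nat} {G : lieGroupType R m}.
Context (H : left_invariant_almost_hermitian G).
Implicit Types U V W : vfield G.
Local Notation J := (almost_complex H).
Local Notation g := (metric H).

Lemma metricDl U V W : g (U + V) W = g U W + g V W.
Proof. by rewrite -[U]scale1r metric_linear mul1r scale1r. Qed.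

Lemma metricNl U W : g (- U) W = - g U W.
Proof.
apply: (addrI (g U W)); rewrite -metricDl !subrr.
by apply: (addrI (g 0 W)); rewrite -metricDl !addr0.
Qed.

Lemma metricNr U W : g U (- W) = - g U W.
Proof. by rewrite metric_sym metricNl metric_sym. Qed.

Lemma metricJl U V : g (J U) V = - g U (J V).
Proof. by rewrite -almost_complex_orthogonal almost_complex_square metricNl. Qed.

Lemma left_invariantJ U : left_invariant U -> left_invariant (J U).
Proof. by move=> iU x; exact: almost_complex_left_invariant (iU x). Qed.

(** The derivative terms of Cartan's formula vanish on left-invariant fields;
    what remains uses omega(X, Y) = - < X, JY >. *)
Lemma ext_d_omega U V W :
  left_invariant U -> left_invariant V -> left_invariant W ->
  ext_d (omega H) U V W =
    g (bracket U V) (J W) + g (bracket V W) (J U) - g (bracket U W) (J V).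
Proof.
move=> iU iV iW; rewrite ext_d_left_invariant// /omega !metricJl !opprK.
by rewrite (bracketC U W) metricNl.
Qed.

Lemma bracketJJl U V : bracket (J (J U)) V = - bracket U V.
Proof. by rewrite almost_complex_square bracketNl. Qed.

Lemma bracketJJr U V : bracket U (J (J V)) = - bracket U V.
Proof. by rewrite almost_complex_square bracketNr. Qed.

Lemma metricJJr U V : g U (J (J V)) = - g U V.
Proof. by rewrite almost_complex_square metricNr. Qed.

Lemma metric_nijenhuis U V W :
  g (nijenhuis H U V) W =
    - g (bracket (J U) V) (J W) - g (bracket U (J V)) (J W)
    + g (bracket U V) W - g (bracket (J U) (J V)) W.
Proof. by rewrite /nijenhuis !(metricDl, metricNl, metricJl). Qed.

(** The brackets are listed with their arguments in the order U, V, W; each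
    coefficient adds the contributions of N and of the four values of
    d omega. *)
Lemma gauduchon_torsion (t : R) D U V W (x : G) : gauduchon H t D ->
  left_invariant U -> left_invariant V -> left_invariant W ->
  g (torsion D U V) W x =
    - (1 / 2) * g (bracket U V) W x
    + (1 - t) / 2 * g (bracket (J U) (J V)) W x
    + t / 4 * g (bracket (J U) V) (J W) x
    + t / 4 * g (bracket U (J V)) (J W) x
    + 1 / 4 * g (bracket V (J W)) (J U) x
    - 1 / 4 * g (bracket U (J W)) (J V) x
    + (1 - 2 * t) / 4 * g (bracket (J V) (J W)) U x
    - (1 - 2 * t) / 4 * g (bracket (J U) (J W)) V x
    + (1 - t) / 4 * g (bracket V W) U x
    - (1 - t) / 4 * g (bracket U W) V x
    + (1 - t) / 4 * g (bracket (J U) W) (J V) x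
    - (1 - t) / 4 * g (bracket (J V) W) (J U) x.
Proof.
move=> [_ _ ->] iU iV iW; rewrite /plus_part.
rewrite !ext_d_omega; try by do ?apply: left_invariantJ.
rewrite metric_nijenhuis !(bracketJJl, bracketJJr) !metricNl !metricJJr.
rewrite !smoothE.
by field.
Qed.

End Gauduchon.

Theorem mainTheorem4 (R : realType) (n : nat) (G : lieGroupType R (n + n))
    (H : left_invariant_almost_hermitian G)
    (e : 'I_(n + n) -> vfield G) (he : standard_frame H e)
    (t : R) (D : vfield G -> vfield G -> vfield G) (hD : gauduchon H t D)
    (i j k : 'I_n) :
  let p (l : 'I_n) := lshift n l in
  let q (l : 'I_n) := rshift n l in
  let c := structure_fun H e in
  let T := torsion D in
  (metric H (T (e (p i)) (e (p j))) (e (p k)) =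
       (t / 4) *: c (q i) (p j) (q k) + (t / 4) *: c (p i) (q j) (q k)
       - (1 / 2) *: c (p i) (p j) (p k) + ((- t + 1) / 2) *: c (q i) (q j) (p k)
       + (1 / 4) *: c (p j) (q k) (q i) + (1 / 4) *: c (q k) (p i) (q j)
       + ((- 2 * t + 1) / 4) *: c (q j) (q k) (p i) + ((- 2 * t + 1) / 4) *: c (q k) (q i) (p j)
       + ((- t + 1) / 4) *: c (p j) (p k) (p i) + ((t - 1) / 4) *: c (p k) (q i) (q j)
       + ((t - 1) / 4) *: c (p i) (p k) (p j) + ((- t + 1) / 4) *: c (p k) (q j) (q i)) /\
  (metric H (T (e (p i)) (e (p j))) (e (q k)) =
       ((- 2 * t + 1) / 4) *: c (q i) (p k) (p j) + ((2 * t - 1) / 4) *: c (q j) (p k) (p i)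
       + ((- t + 1) / 2) *: c (q i) (q j) (q k) + ((- t + 1) / 4) *: c (q i) (q k) (q j)
       + ((t - 1) / 4) *: c (q j) (q k) (q i) - (t / 4) *: c (p i) (q j) (p k)
       + ((t - 1) / 4) *: c (p i) (q k) (p j) + ((- t + 1) / 4) *: c (p j) (q k) (p i)
       - (t / 4) *: c (q i) (p j) (p k) - (1 / 2) *: c (p i) (p j) (q k)
       + (1 / 4) *: c (p i) (p k) (q j) - (1 / 4) *: c (p j) (p k) (q i)) /\
  (metric H (T (e (p i)) (e (q j))) (e (p k)) =
       ((- t + 1) / 4) *: c (q j) (p k) (p i) + (t / 4) *: c (q i) (q j) (q k)
       + ((2 * t - 1) / 4) *: c (q i) (q k) (q j) - (t / 4) *: c (p i) (p j) (q k)
       + ((t - 1) / 4) *: c (p i) (p k) (q j) + ((- t + 1) / 4) *: c (p j) (p k) (q i)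
       + ((2 * t - 1) / 4) *: c (p j) (q k) (p i) + ((t - 1) / 2) *: c (q i) (p j) (p k)
       + ((t - 1) / 4) *: c (q i) (p k) (p j) + (1 / 4) *: c (q j) (q k) (q i)
       - (1 / 2) *: c (p i) (q j) (p k) + (1 / 4) *: c (p i) (q k) (p j)) /\
  (metric H (T (e (p i)) (e (q j))) (e (q k)) =
       (- (t / 4)) *: c (q i) (q j) (p k) + ((t - 1) / 4) *: c (q i) (q k) (p j)
       + ((- t + 1) / 4) *: c (q j) (q k) (p i) + (t / 4) *: c (p i) (p j) (p k)
       + ((- 2 * t + 1) / 4) *: c (p j) (p k) (p i) + ((t - 1) / 4) *: c (p i) (q k) (q j)
       + ((- t + 1) / 4) *: c (p j) (q k) (q i) + ((t - 1) / 2) *: c (q i) (p j) (q k)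
       + ((- 2 * t + 1) / 4) *: c (q i) (p k) (q j) - (1 / 2) *: c (p i) (q j) (q k)
       - (1 / 4) *: c (p i) (p k) (p j) - (1 / 4) *: c (q j) (p k) (q i)) /\
  (metric H (T (e (q i)) (e (q j))) (e (p k)) =
       ((- t + 1) / 4) *: c (q j) (p k) (q i) + ((- t + 1) / 2) *: c (p i) (p j) (p k)
       + ((- t + 1) / 4) *: c (p i) (p k) (p j) + ((t - 1) / 4) *: c (p j) (p k) (p i)
       - (t / 4) *: c (p i) (q j) (q k) + ((- 2 * t + 1) / 4) *: c (p i) (q k) (q j)
       + ((2 * t - 1) / 4) *: c (p j) (q k) (q i) - (t / 4) *: c (q i) (p j) (q k)
       + ((t - 1) / 4) *: c (q i) (p k) (q j) - (1 / 2) *: c (q i) (q j) (p k)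
       + (1 / 4) *: c (q i) (q k) (p j) - (1 / 4) *: c (q j) (q k) (p i)) /\
  (metric H (T (e (q i)) (e (q j))) (e (q k)) =
       ((t - 1) / 4) *: c (q i) (q k) (q j) + ((- t + 1) / 4) *: c (q j) (q k) (q i)
       + ((- t + 1) / 2) *: c (p i) (p j) (q k) + ((2 * t - 1) / 4) *: c (p i) (p k) (q j)
       + (t / 4) *: c (p i) (q j) (p k) + ((- t + 1) / 4) *: c (p i) (q k) (p j)
       + ((- 2 * t + 1) / 4) *: c (p j) (p k) (q i) + ((t - 1) / 4) *: c (p j) (q k) (p i)
       + (t / 4) *: c (q i) (p j) (p k) + (1 / 4) *: c (q j) (p k) (p i)
       - (1 / 2) *: c (q i) (q j) (q k) - (1 / 4) *: c (q i) (p k) (p j)).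
Proof.
move=> p q c T.
have [ie _ Je] := he.
have Jp l : almost_complex H (e (p l)) = e (q l) by exact: Je.
(* Four brackets of the first formula start with e_k or e_(n+k). *)
have cC a b d : c a b d = - c b a d by rewrite /c /structure_fun bracketC metricNl.
do !split; apply: smoothP => x; rewrite (gauduchon_torsion _ _ _ _ _ _ _ hD) //.
- rewrite (cC (q k) (p i)) (cC (q k) (q i)) (cC (p k) (q i)) (cC (p k) (q j)).
  by rewrite /c /structure_fun -!Jp !smoothE; field.
(* With every e_(n+l) written as J e_l, signs come only from J^2 = -1. *)
all: rewrite /c /structure_fun -!Jp !(bracketJJl, bracketJJr) !metricNl !metricJJr.
all: by rewrite !smoothE; field.
Qed.
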